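(* Let $R=R_0\oplus R_1$ be a $\mathbb{Z}_2$-graded commutative ring. Then the map $\varphi:\mathbb{Z}_2\mathrm{Spec}\,R\to\mathrm{Spec}\,R_0$, $\varphi(P)=P\cap R_0$, is a homeomorphism of topological spaces with respect to the Zariski topologies.
   Context: $\mathbb{Z}_2=\mathbb{Z}/2\mathbb{Z}$. A $\mathbb{Z}_2$-graded commutative ring is a commutative ring $R$ with unit together with additive subgroups $R_0,R_1$ such that $R=R_0\oplus R_1$ and $R_iR_j\subseteq R_{i+j}$ for all $i,j\in\mathbb{Z}_2$; then $R_0$ is a subring. Homogeneous elements are the elements of $R_0\cup R_1$. An ideal $I$ of $R$ is $\mathbb{Z}_2$-graded if $I=(I\cap R_0)\oplus(I\cap R_1)$. A $\mathbb{Z}_2$-graded ideal $P\neq R$ is $\mathbb{Z}_2$-graded prime if whenever $r,s$ are homogeneous elements with $rs\in P$, then $r\in P$ or $s\in P$. $\mathbb{Z}_2\mathrm{Spec}\,R$ is the set of all $\mathbb{Z}_2$-graded prime ideals of $R$; its Zariski topology has as closed sets the sets $\{P\in\mathbb{Z}_2\mathrm{Spec}\,R : I\subseteq P\}$, with $I$ a $\mathbb{Z}_2$-graded ideal of $R$. $\mathrm{Spec}\,R_0$ carries the usual Zariski topology. *)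

(* Defs.v *)
From HB Require Import structures.
From mathcomp Require Import all_boot all_algebra.
From mathcomp Require Import all_classical topology.

Set Implicit Arguments.
Unset Strict Implicit.
Unset Printing Implicit Defensive.

Import GRing.Theory.
Local Open Scope classical_set_scope.
Local Open Scope ring_scope.

(* [comPzRingType] allows the zero ring, whose spectra are empty. *)

(* The internal direct sum C = A (+) B, for additive subgroups A and B. *)
Definition direct_sum (V : zmodType) (A B C : set V) : Prop :=
  C = [set x + y | x in A & y in B] /\ A `&` B = [set 0].

Record Z2grading (R : comPzRingType) := Z2Grading {
  graded_part :> 'Z_2 -> set R;
  graded_part_zmod : forall i, zmod_closed [in graded_part i];
  graded_part_sum : direct_sum (graded_part 0) (graded_part 1) [set: R];
  graded_part_mul : forall i j x y,
    graded_part i x -> graded_part j y -> graded_part (i + j) (x * y)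
}.

Definition homogeneous (R : comPzRingType) (G : Z2grading R) : set R :=
  G 0 `|` G 1.

Section Ideals.
Variable R : comPzRingType.

(* Not necessarily proper. *)
Definition ideal (I : set R) : Prop :=
  zmod_closed [in I] /\ forall a x, I x -> I (a * x).

Definition prime_ideal (P : set R) : Prop :=
  [/\ ideal P, P <> [set: R] & forall r s, P (r * s) -> P r \/ P s].

Variable G : Z2grading R.

Definition graded_ideal (I : set R) : Prop :=
  ideal I /\ direct_sum (I `&` G 0) (I `&` G 1) I.

Definition graded_prime_ideal (P : set R) : Prop :=
  [/\ graded_ideal P, P <> [set: R] &
    forall r s, homogeneous G r -> homogeneous G s ->
      P (r * s) -> P r \/ P s].

End Ideals.

Section IdealTheory.
Variable R : comPzRingType.
Implicit Types I J : set R.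

Lemma zmod_closed_setP (V : zmodType) (A : set V) : zmod_closed [in A] <->
  A 0 /\ forall x y, A x -> A y -> A (x - y).
Proof.
split=> -[A0 AB]; (split; first by [exact: set_mem|exact: mem_set]) => x y.
  by move=> Ax Ay; apply: set_mem; apply: AB; exact: mem_set.
by move=> Ax Ay; apply: mem_set; apply: AB; exact: set_mem.
Qed.

Lemma idealP I : ideal I <->
  [/\ I 0, forall x y, I x -> I y -> I (x - y) & forall a x, I x -> I (a * x)].
Proof.
split=> [[/zmod_closed_setP[I0 IB] IM]|[I0 IB IM]]; first by split.
by split=> //; exact/zmod_closed_setP.
Qed.

Lemma idealT : ideal [set: R].
Proof. exact/idealP. Qed.

Lemma ideal0 I : ideal I -> I 0.
Proof. by case/idealP. Qed.

Lemma idealD I x y : ideal I -> I x -> I y -> I (x + y).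
Proof.
case/idealP=> I0 IB _ Ix Iy; rewrite -[y]opprK; apply: (IB) => //.
by rewrite -[- y]add0r; exact: IB.
Qed.

Lemma idealI I J : ideal I -> ideal J -> ideal (I `&` J).
Proof.
move=> /idealP[I0 IB IM] /idealP[J0 JB JM]; apply/idealP; split=> //.
  by move=> x y [? ?] [? ?]; split; [exact: IB|exact: JB].
by move=> a x [? ?]; split; [exact: IM|exact: JM].
Qed.

Lemma ideal_bigcap (F : set (set R)) :
  (forall K, F K -> ideal K) -> ideal (\bigcap_(K in F) K).
Proof.
move=> FI; apply/idealP; split=> [K /FI/ideal0//|x y Fx Fy K FK|a x Fx K FK].
  by have /idealP[_ + _] := FI _ FK; apply; [exact: Fx|exact: Fy].
by have /idealP[_ _] := FI _ FK; apply; exact: Fx.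
Qed.

Lemma ideal_neqT I : ideal I -> I <> [set: R] <-> ~ I 1.
Proof.
move=> /idealP[_ _ IM]; split=> [IT I1|I1 IT]; last by apply: I1; rewrite IT.
by apply: IT; apply/seteqP; split=> // x _; rewrite -[x]mulr1; exact: IM.
Qed.

End IdealTheory.

Section GradingTheory.
Variables (R : comPzRingType) (G : Z2grading R).
Implicit Types I J : set R.

Lemma graded_partB i x y : G i x -> G i y -> G i (x - y).
Proof.
by have /zmod_closed_setP[_] := graded_part_zmod G i; exact.
Qed.

Lemma graded_part0 i : G i 0.
Proof. by have /zmod_closed_setP[] := graded_part_zmod G i. Qed.

Lemma graded_partI x : G 0 x -> G 1 x -> x = 0.
Proof.
have [_ GI] := graded_part_sum G => G0x G1x.
by have : (G 0 `&` G 1) x by []; rewrite GI.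
Qed.

Lemma graded_dec x : exists x0 x1, [/\ G 0 x0, G 1 x1 & x = x0 + x1].
Proof.
have [GT _] := graded_part_sum G; have : [set: R] x by [].
by rewrite GT => -[x0 ? [x1 ? <-]]; exists x0, x1.
Qed.

Lemma graded_dec_inj x0 x1 y0 y1 : G 0 x0 -> G 1 x1 -> G 0 y0 -> G 1 y1 ->
  x0 + x1 = y0 + y1 -> x0 = y0 /\ x1 = y1.
Proof.
move=> G0x G1x G0y G1y exy.
have e : x0 - y0 = y1 - x1.
  by apply/eqP; rewrite subr_eq addrAC eq_sym subr_eq [y1 + _]addrC exy.
have e0 : x0 - y0 = 0.
  by apply: graded_partI; [|rewrite e]; exact: graded_partB.
split; apply/eqP; first by rewrite -subr_eq0 e0.
by rewrite eq_sym -subr_eq0 -e e0.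
Qed.

Lemma graded_part_mul00 x y : G 0 x -> G 0 y -> G 0 (x * y).
Proof. by move=> Gx Gy; rewrite -[0](addr0 0); exact: graded_part_mul. Qed.

Lemma graded_part_mul01 x y : G 0 x -> G 1 y -> G 1 (x * y).
Proof. by move=> Gx Gy; rewrite -[1](add0r 1); exact: graded_part_mul. Qed.

Lemma graded_part_mul11 x y : G 1 x -> G 1 y -> G 0 (x * y).
Proof.
move=> Gx Gy; have -> : 0 = 1 + 1 :> 'Z_2 by exact/val_inj.
exact: graded_part_mul.
Qed.

Lemma graded_part1 : G 0 1.
Proof.
have [a [b [Ga Gb e]]] := graded_dec 1.
have [_ ab] : 0 = b * b /\ b = a * b.
  apply: graded_dec_inj => //.
  - exact: graded_part0.
  - exact: graded_part_mul11.
  - exact: graded_part_mul01.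
  - by rewrite add0r addrC -mulrDl -e mul1r.
have [_ ab0] : a = a * a /\ 0 = a * b.
  apply: graded_dec_inj => //.
  - exact: graded_part0.
  - exact: graded_part_mul00.
  - exact: graded_part_mul01.
  - by rewrite addr0 -mulrDr -e mulr1.
by rewrite e ab -ab0 addr0.
Qed.

Lemma graded_idealP I : graded_ideal G I <-> ideal I /\
  forall x0 x1, G 0 x0 -> G 1 x1 -> I (x0 + x1) -> I x0 /\ I x1.
Proof.
split=> -[idI]; last first.
  move=> IG; split=> //; split; last first.
    apply/seteqP; split=> x; first by move=> [[_ ?] [_ ?]]; exact: graded_partI.
    by move=> ->; split; (split; [exact: ideal0|exact: graded_part0]).
  apply/seteqP; split=> x.
    move=> Ix; have [x0 [x1 [Gx0 Gx1 ex]]] := graded_dec x.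
    have [|Ix0 Ix1] := IG x0 x1 Gx0 Gx1; first by rewrite -ex.
    by exists x0 => //; exists x1.
  by move=> [x0 [Ix0 _] [x1 [Ix1 _] <-]]; exact: idealD.
move=> [+ _] => IE; split=> // x0 x1 Gx0 Gx1; rewrite {1}IE.
move=> [y0 [Iy0 Gy0] [y1 [Iy1 Gy1] e]].
by have [<- <-] := graded_dec_inj Gy0 Gy1 Gx0 Gx1 e.
Qed.

Lemma graded_idealT : graded_ideal G [set: R].
Proof. by apply/graded_idealP; split=> //; exact: idealT. Qed.

Lemma graded_idealI I J :
  graded_ideal G I -> graded_ideal G J -> graded_ideal G (I `&` J).
Proof.
move=> /graded_idealP[idI IG] /graded_idealP[idJ JG].
apply/graded_idealP; split; first exact: idealI.
move=> x0 x1 G0 G1 [Ix Jx].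
by have [? ?] := IG _ _ G0 G1 Ix; have [? ?] := JG _ _ G0 G1 Jx.
Qed.

Lemma graded_ideal_bigcap (F : set (set R)) :
  (forall K, F K -> graded_ideal G K) -> graded_ideal G (\bigcap_(K in F) K).
Proof.
move=> FI; apply/graded_idealP; split.
  by apply: ideal_bigcap => K /FI[].
move=> x0 x1 G0 G1 Fx; split=> K FK; have /graded_idealP[_ KG] := FI _ FK;
  by have [] := KG _ _ G0 G1 (Fx _ FK).
Qed.

Lemma graded_ideal_nsub I (P : set R) : graded_ideal G I -> ideal P ->
  ~ I `<=` P -> exists x, [/\ homogeneous G x, I x & ~ P x].
Proof.
move=> /graded_idealP[_ IG] idP /existsNP[x /not_implyP[Ix Px]].
have [x0 [x1 [Gx0 Gx1 ex]]] := graded_dec x; move: Ix Px.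
rewrite {x}ex => /(IG _ _ Gx0 Gx1)[Ix0 Ix1] Px.
have [Px0|Px0] := pselect (P x0); last by exists x0; split=> //; left.
exists x1; split=> //; first by right.
by move=> Px1; apply: Px; exact: idealD.
Qed.

End GradingTheory.

Record spectrum (R : comPzRingType) := Spectrum {
  spectrum_ideal :> set R;
  spectrum_prime : prime_ideal spectrum_ideal
}.

Record Z2spectrum (R : comPzRingType) (G : Z2grading R) := Z2Spectrum {
  Z2spectrum_ideal :> set R;
  Z2spectrum_prime : graded_prime_ideal G Z2spectrum_ideal
}.

HB.instance Definition _ (R : comPzRingType) := gen_eqMixin (spectrum R).
HB.instance Definition _ (R : comPzRingType) := gen_choiceMixin (spectrum R).
HB.instance Definition _ (R : comPzRingType) (G : Z2grading R) :=
  gen_eqMixin (Z2spectrum G).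
HB.instance Definition _ (R : comPzRingType) (G : Z2grading R) :=
  gen_choiceMixin (Z2spectrum G).

Section Zariski.
Variable R : comPzRingType.

Definition zero_locus (I : set R) : set (spectrum R) :=
  [set P : spectrum R | I `<=` P].

Definition zariski_open (U : set (spectrum R)) : Prop :=
  exists2 I, ideal I & U = ~` zero_locus I.

Lemma zariski_openT : zariski_open setT.
Proof.
exists [set: R]; first exact: idealT.
apply/seteqP; split=> // P _ TP; have [_ + _] := spectrum_prime P; apply.
by apply/seteqP; split.
Qed.

Lemma zariski_openI : setI_closed zariski_open.
Proof.
move=> _ _ [I idI ->] [J idJ ->]; exists (I `&` J); first exact: idealI.
rewrite -setCU; congr (~` _); apply/seteqP; split=> P.
  by case=> [IP x [/IP]|JP x [_ /JP]].
move=> IJP; have [IP|] := pselect (I `<=` P); first by left.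
move=> /existsNP[x /not_implyP[Ix Px]]; right=> y Jy.
have [_ _ /(_ x y)[|//|//]] := spectrum_prime P.
apply: IJP; split; last by case: idJ => _; apply.
by rewrite mulrC; case: idI => _; apply.
Qed.

Lemma zariski_open_bigU (T : Type) (f : T -> set (spectrum R)) :
  (forall i, zariski_open (f i)) -> zariski_open (\bigcup_i f i).
Proof.
move=> fo; pose F := [set K | ideal K /\
  forall i I, f i = ~` zero_locus I -> I `<=` K].
exists (\bigcap_(K in F) K); first by apply: ideal_bigcap => K [].
apply/seteqP; split=> P.
  move=> [i _ fP] FP; have [I idI fI] := fo i.
  move: fP; rewrite fI; apply=> x Ix; apply: FP => K [_ FK].
  exact: (FK _ _ fI).
move=> FP; apply: contrapT => nfP; apply: FP => x; apply; split.
  by have [] := spectrum_prime P.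
move=> i I fI; apply: contrapT => nIP; apply: nfP; exists i => //.
by rewrite fI.
Qed.

HB.instance Definition _ := isOpenTopological.Build (spectrum R)
  zariski_openT zariski_openI zariski_open_bigU.

Lemma closed_spectrumE (C : set (spectrum R)) :
  closed C <-> exists2 I, ideal I & C = zero_locus I.
Proof.
rewrite -openC; split=> -[I idI CE]; exists I => //; last by rewrite CE.
exact: setC_inj.
Qed.

End Zariski.

Section Z2Zariski.
Variables (R : comPzRingType) (G : Z2grading R).

Definition Z2zero_locus (I : set R) : set (Z2spectrum G) :=
  [set P : Z2spectrum G | I `<=` P].

Definition Z2zariski_open (U : set (Z2spectrum G)) : Prop :=
  exists2 I, graded_ideal G I & U = ~` Z2zero_locus I.

Lemma Z2zariski_openT : Z2zariski_open setT.
Proof.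
exists [set: R]; first exact: graded_idealT.
apply/seteqP; split=> // P _ TP; have [_ + _] := Z2spectrum_prime P; apply.
by apply/seteqP; split.
Qed.

Lemma Z2zariski_openI : setI_closed Z2zariski_open.
Proof.
move=> _ _ [I idI ->] [J idJ ->]; exists (I `&` J); first exact: graded_idealI.
rewrite -setCU; congr (~` _); apply/seteqP; split=> P.
  by case=> [IP x [/IP]|JP x [_ /JP]].
move=> IJP; apply: contrapT => /not_orP[].
have [[idP _] _ Pprime] := Z2spectrum_prime P.
move=> /(graded_ideal_nsub idI idP)[x [Hx Ix Px]].
move=> /(graded_ideal_nsub idJ idP)[y [Hy Jy Py]].
have [|//|//] := Pprime x y Hx Hy.
apply: IJP; split; last by case: idJ => -[_ + _]; apply.
by rewrite mulrC; case: idI => -[_ + _]; apply.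
Qed.

Lemma Z2zariski_open_bigU (T : Type) (f : T -> set (Z2spectrum G)) :
  (forall i, Z2zariski_open (f i)) -> Z2zariski_open (\bigcup_i f i).
Proof.
move=> fo; pose F := [set K | graded_ideal G K /\
  forall i I, f i = ~` Z2zero_locus I -> I `<=` K].
exists (\bigcap_(K in F) K); first by apply: graded_ideal_bigcap => K [].
apply/seteqP; split=> P.
  move=> [i _ fP] FP; have [I idI fI] := fo i.
  move: fP; rewrite fI; apply=> x Ix; apply: FP => K [_ FK].
  exact: (FK _ _ fI).
move=> FP; apply: contrapT => nfP; apply: FP => x; apply; split.
  by have [] := Z2spectrum_prime P.
move=> i I fI; apply: contrapT => nIP; apply: nfP; exists i => //.
by rewrite fI.
Qed.

HB.instance Definition _ := isOpenTopological.Build (Z2spectrum G)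
  Z2zariski_openT Z2zariski_openI Z2zariski_open_bigU.

Lemma closed_Z2spectrumE (C : set (Z2spectrum G)) :
  closed C <-> exists2 I, graded_ideal G I & C = Z2zero_locus I.
Proof.
rewrite -openC; split=> -[I idI CE]; exists I => //; last by rewrite CE.
exact: setC_inj.
Qed.

End Z2Zariski.

(* R_0 as a ring in its own right. *)
Section EvenSubring.
Variables (R : comPzRingType) (G : Z2grading R).

Definition even_pred : {pred R} := mem (G 0).

Fact even_subring_closed : subring_closed even_pred.
Proof.
split=> [|x y /set_mem ? /set_mem ?|x y /set_mem ? /set_mem ?]; apply/mem_set.
- exact: graded_part1.
- exact: graded_partB.
- exact: graded_part_mul00.
Qed.

Definition even_subring := {x : R | x \in even_pred}.
HB.instance Definition _ := SubChoice.on even_subring.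
HB.instance Definition _ := GRing.SubChoice_isSubComPzRing.Build R
  (fun x => x \in even_pred) even_subring even_subring_closed.

End EvenSubring.

Section Contraction.
Variables (R : comPzRingType) (G : Z2grading R).

(* P `&` G 0, as a subset of the ring R_0. *)
Definition contraction_ideal (P : Z2spectrum G) : set (even_subring G) :=
  val @^-1` (P : set R).

Lemma val_contraction_ideal (P : Z2spectrum G) :
  val @` contraction_ideal P = P `&` G 0.
Proof.
apply/seteqP; split=> [_ [x Px <-]|x [Px /mem_set Gx]].
  by split=> //; exact/set_mem/(valP x).
by exists (Sub x Gx) => //; rewrite /contraction_ideal /= SubK.
Qed.

Fact contraction_prime (P : Z2spectrum G) : prime_ideal (contraction_ideal P).
Proof.
have [[idP _] PT Pprime] := Z2spectrum_prime P.
have idQ : ideal (contraction_ideal P).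
  have /idealP[P0 PB PM] := idP; apply/idealP.
  rewrite /contraction_ideal /preimage /mkset; split.
  - by rewrite raddf0.
  - by move=> x y Px Py; rewrite raddfB; exact: PB.
  - by move=> a x Px; rewrite rmorphM; exact: PM.
split=> //.
  apply/(ideal_neqT idQ); rewrite /contraction_ideal /preimage /mkset rmorph1.
  exact/(ideal_neqT idP).
move=> r s; rewrite /contraction_ideal /preimage /mkset rmorphM; apply: Pprime.
  by left; exact/set_mem/(valP r).
by left; exact/set_mem/(valP s).
Qed.

Definition contraction (P : Z2spectrum G) : spectrum (even_subring G) :=
  Spectrum (contraction_prime P).

End Contraction.

Definition homeomorphism (X Y : topologicalType) (f : X -> Y) : Prop :=
  exists g : Y -> X, [/\ cancel f g, cancel g f, continuous f & continuous g].

(* Main.v *)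
Require Import Defs.
From mathcomp Require Import all_boot all_algebra.
From mathcomp Require Import all_classical topology.

Set Implicit Arguments.
Unset Strict Implicit.
Unset Printing Implicit Defensive.

Import GRing.Theory.
Local Open Scope classical_set_scope.
Local Open Scope ring_scope.

(** The point is that the square of a homogeneous element is even. A graded
    prime P therefore contains a homogeneous r exactly when the even element
    r ^+ 2 lies in P, so P is determined by its even part P `&` G 0; this
    forces the inverse map. A prime Q of R_0 has to go to the set of all
    x0 + x1 with x0 even, x1 odd and both squares in Q ([extension] below).
    The components of degree i whose square lies in Q form a subgroup, because
    in (x - y) ^+ 2 = x ^+ 2 + y ^+ 2 - 2 x y the product x * y is even and
    has its square x ^+ 2 * y ^+ 2 in Q, hence lies in Q itself
    ([sqrt_partB]); comparing squares also shows that the extension is a graded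
    prime ([extension_prime]), and on homogeneous elements membership in it is
    again a condition on squares ([extension_homogeneous]).

    Both maps are continuous because preimages of zero loci are zero loci: the
    preimage of V(J) under contraction is V(K), with K the graded ideal
    generated by J, and the preimage of V(I) under extension is V(I `&` R_0),
    as a homogeneous r in I has its square in I `&` R_0. *)

(** * Homogeneous elements and their squares *)

Section GradedComplements.
Variables (R : comPzRingType) (G : Z2grading R).

(** In Z/2 a degree added to itself vanishes; this is where the argument uses
    that the grading group is Z/2. *)
Lemma graded_part_mulii i x y : G i x -> G i y -> G 0 (x * y).
Proof.
move=> Gx Gy.
have -> : 0 = i + i by case: i {Gx Gy} => -[|[|//]] ?; exact/val_inj.
exact: graded_part_mul.
Qed.

Lemma homogeneousE x : homogeneous G x <-> exists i, G i x.
Proof.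
split=> [[Gx|Gx]|[[[|[|//]] lti] Gx]]; [by exists 0|by exists 1|left|right].
  by have <- : Ordinal lti = 0 by exact/val_inj.
by have <- : Ordinal lti = 1 by exact/val_inj.
Qed.

Lemma even_lift x : G 0 x -> exists y : even_subring G, x = val y.
Proof. by move=> /mem_set Gx; exists (Sub x Gx); rewrite SubK. Qed.

(** A graded ideal is generated by its homogeneous elements, so inclusions can
    be tested on these. *)
Lemma graded_ideal_sub (I J : set R) : graded_ideal G I -> ideal J ->
  (forall r, homogeneous G r -> I r -> J r) -> I `<=` J.
Proof.
move=> gI idJ IJ; apply: contrapT => /(graded_ideal_nsub gI idJ)[r [Hr Ir]].
by apply; exact: IJ.
Qed.

(** Since r ^+ 2 is even, a graded prime is determined by its contraction:
    this is the reason for the injectivity of the contraction map. *)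
Lemma graded_prime_sqr (P : Z2spectrum G) r : homogeneous G r ->
  (P : set R) (r ^+ 2) <-> (P : set R) r.
Proof.
have [[/idealP[_ _ PM] _] _ Pprime] := Z2spectrum_prime P.
by move=> Hr; rewrite expr2; split=> [/Pprime[]|/PM].
Qed.

End GradedComplements.

(** * The graded prime lying over a prime of the even subring *)

Section Extension.
Variables (R : comPzRingType) (G : Z2grading R).
Variable Q : spectrum (even_subring G).

(** Working with the image of Q in R lets all degrees be treated in one ring,
    without injecting even elements into the subring type. *)
Definition even_image : set R := val @` (Q : set (even_subring G)).

Lemma even_imageE (x : even_subring G) : even_image (val x) <-> spectrum_ideal Q x.
Proof. by split=> [[y Qy /val_inj <-]|Qx] //; exists x. Qed.

Lemma even_image_even x : even_image x -> G 0 x.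
Proof. by move=> [y _ <-]; exact/set_mem/(valP y). Qed.

Lemma even_image0 : even_image 0.
Proof.
have [/ideal0 Q0 _ _] := spectrum_prime Q.
by exists 0 => //; rewrite raddf0.
Qed.

Lemma even_imageB x y : even_image x -> even_image y -> even_image (x - y).
Proof.
have [/idealP[_ QB _] _ _] := spectrum_prime Q.
by move=> [a Qa <-] [b Qb <-]; rewrite -raddfB; exists (a - b) => //; exact: QB.
Qed.

Lemma even_imageM a x : G 0 a -> even_image x -> even_image (a * x).
Proof.
have [/idealP[_ _ QM] _ _] := spectrum_prime Q.
move=> /even_lift[b ->] [c Qc <-]; rewrite -rmorphM.
by exists (b * c) => //; exact: QM.
Qed.

Lemma even_image_prime a b : G 0 a -> G 0 b -> even_image (a * b) ->
  even_image a \/ even_image b.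
Proof.
have [_ _ Qprime] := spectrum_prime Q.
move=> /even_lift[c ->] /even_lift[d ->]; rewrite -rmorphM.
by move=> /even_imageE/Qprime[]; [left|right]; exact/even_imageE.
Qed.

Lemma even_image_sqr a : G 0 a -> even_image (a ^+ 2) <-> even_image a.
Proof.
move=> Ga; rewrite expr2; split=> [/(even_image_prime Ga Ga)[]//|].
exact: even_imageM.
Qed.

Lemma even_image1 : ~ even_image 1.
Proof.
have [idQ QT _] := spectrum_prime Q.
have <- : val (1 : even_subring G) = 1 by rewrite rmorph1.
by move=> /even_imageE; exact/ideal_neqT.
Qed.

(** The degree i part of the graded prime over Q. The same formula serves both
    degrees, as Q is radical ([sqrt_part0E]); this avoids case distinctions on
    degrees in the closure properties below. *)
Definition sqrt_part (i : 'Z_2) : set R :=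
  [set x | G i x /\ even_image (x ^+ 2)].

Lemma sqrt_part0E : sqrt_part 0 = even_image.
Proof.
apply/seteqP; split=> x; first by case=> Gx /even_image_sqr; exact.
by move=> Qx; have Gx := even_image_even Qx; split=> //; exact/even_image_sqr.
Qed.

Lemma sqrt_part_0 i : sqrt_part i 0.
Proof. by split; [exact: graded_part0|rewrite expr0n; exact: even_image0]. Qed.

(** Squares of sums are controlled because x * y lies in R_0, where Q is prime:
    (x * y) ^+ 2 = x ^+ 2 * y ^+ 2 is in Q, hence so is x * y. *)
Lemma sqrt_partB i x y : sqrt_part i x -> sqrt_part i y -> sqrt_part i (x - y).
Proof.
move=> [Gx Qx] [Gy Qy]; split; first exact: graded_partB.
have Gxy : G 0 (x * y) by exact: (graded_part_mulii Gx Gy).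
have Qxy : even_image (x * y).
  apply/even_image_sqr => //; rewrite exprMn; apply: even_imageM => //.
  exact: even_image_even.
have -> : (x - y) ^+ 2 = x ^+ 2 - x * y - (x * y - y ^+ 2).
  by rewrite sqrrB mulr2n !opprD opprK !addrA.
by do 2!apply: even_imageB => //; apply: even_imageB.
Qed.

Lemma sqrt_partM i j a x : G i a -> sqrt_part j x -> sqrt_part (i + j) (a * x).
Proof.
move=> Ga [Gx Qx]; split; first exact: graded_part_mul.
rewrite exprMn expr2; apply: even_imageM => //.
exact: (graded_part_mulii Ga Ga).
Qed.

Definition extension_ideal : set R :=
  [set x | exists x0 x1, [/\ sqrt_part 0 x0, sqrt_part 1 x1 & x = x0 + x1]].

Lemma extension_dec x0 x1 : G 0 x0 -> G 1 x1 -> extension_ideal (x0 + x1) ->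
  sqrt_part 0 x0 /\ sqrt_part 1 x1.
Proof.
move=> Gx0 Gx1 [y0 [y1 [Sy0 Sy1 e]]].
by have [-> ->] := graded_dec_inj Gx0 Gx1 Sy0.1 Sy1.1 e.
Qed.

Lemma extension_part i x : G i x -> extension_ideal x <-> sqrt_part i x.
Proof.
case: i => -[|[|//]] lti.
  have -> : Ordinal lti = 0 by exact/val_inj.
  move=> Gx; split=> [|Sx]; last first.
    by exists x, 0; split; rewrite ?addr0//; exact: sqrt_part_0.
  by rewrite -{1}[x]addr0 => /(extension_dec Gx (graded_part0 _ _))[].
have -> : Ordinal lti = 1 by exact/val_inj.
move=> Gx; split=> [|Sx]; last first.
  by exists 0, x; split; rewrite ?add0r//; exact: sqrt_part_0.
by rewrite -{1}[x]add0r => /(extension_dec (graded_part0 _ _) Gx)[].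
Qed.

(** The counterpart of [graded_prime_sqr] for the extension. *)
Lemma extension_homogeneous r : homogeneous G r ->
  extension_ideal r <-> even_image (r ^+ 2).
Proof.
move=> /homogeneousE[i Gr].
by split=> [/(extension_part Gr)[]//|Qr]; exact/(extension_part Gr).
Qed.

Lemma extension_idealP : ideal extension_ideal.
Proof.
have EB x y : extension_ideal x -> extension_ideal y -> extension_ideal (x - y).
  move=> [x0 [x1 [Sx0 Sx1 ->]]] [y0 [y1 [Sy0 Sy1 ->]]].
  exists (x0 - y0), (x1 - y1); split; [exact: sqrt_partB..|].
  by rewrite opprD addrACA.
have E0 : extension_ideal 0.
  exact/(extension_part (graded_part0 G 0))/sqrt_part_0.
have ED x y : extension_ideal x -> extension_ideal y -> extension_ideal (x + y).
  by move=> Ex Ey; rewrite -[y]opprK -[- y]add0r; do 2!apply: (EB) => //.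
apply/idealP; split=> // a _ [x0 [x1 [Sx0 Sx1 ->]]].
have EM i j b x : G i b -> sqrt_part j x -> extension_ideal (b * x).
  move=> Gb Sx; have Sbx := sqrt_partM Gb Sx.
  by apply/(extension_part Sbx.1).
have [a0 [a1 [Ga0 Ga1 ->]]] := graded_dec G a.
by rewrite mulrDl !mulrDr; apply: (ED); apply: (ED); apply: EM; eassumption.
Qed.

(** For homogeneous r and s, (r * s) ^+ 2 = r ^+ 2 * s ^+ 2 is a product of two
    elements of R_0, so primality of Q can be applied to the squares. *)
Lemma extension_prime : graded_prime_ideal G extension_ideal.
Proof.
have sqr0 r : homogeneous G r -> G 0 (r ^+ 2).
  by move=> /homogeneousE[i Gr]; exact: (graded_part_mulii Gr Gr).
split.
- apply/graded_idealP; split; first exact: extension_idealP.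
  move=> x0 x1 Gx0 Gx1 /(extension_dec Gx0 Gx1)[Sx0 Sx1].
  by split; [exact/(extension_part Gx0)|exact/(extension_part Gx1)].
- apply/(ideal_neqT extension_idealP) => /(extension_part (graded_part1 G)).
  by rewrite sqrt_part0E; exact: even_image1.
- move=> r s Hr Hs; have Hrs : homogeneous G (r * s).
    have /homogeneousE[i Gr] := Hr; have /homogeneousE[j Gs] := Hs.
    by apply/homogeneousE; exists (i + j); exact: graded_part_mul.
  move=> /(extension_homogeneous Hrs); rewrite exprMn.
  move=> /(even_image_prime (sqr0 _ Hr) (sqr0 _ Hs))[?|?]; [left|right];
    exact/extension_homogeneous.
Qed.

Definition extension : Z2spectrum G := Z2Spectrum extension_prime.

End Extension.

(** * Contraction and extension are inverse and continuous *)

Section Homeomorphism.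
Variables (R : comPzRingType) (G : Z2grading R).

Lemma spectrum_inj (S : comPzRingType) (P Q : spectrum S) :
  (P : set S) = Q -> P = Q.
Proof.
by case: P Q => [P pP] [Q pQ] /= e; case: _ / e pQ => pQ; congr Spectrum.
Qed.

Lemma Z2spectrum_inj (P Q : Z2spectrum G) : (P : set R) = Q -> P = Q.
Proof.
by case: P Q => [P pP] [Q pQ] /= e; case: _ / e pQ => pQ; congr Z2Spectrum.
Qed.

Lemma extensionK : cancel (@extension R G) (@contraction R G).
Proof.
move=> Q; apply/spectrum_inj/seteqP; split=> x /=;
  rewrite /contraction_ideal /preimage /mkset /=;
  have Gx : G 0 (val x) by exact/set_mem/(valP x).
  by move=> /(extension_part _ Gx); rewrite sqrt_part0E => /even_imageE.
by move=> Qx; apply/(extension_part _ Gx); rewrite sqrt_part0E; exact/even_imageE.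
Qed.

(** P and the extension of its contraction are graded ideals with the same
    homogeneous elements, namely those whose square lies in P. *)
Lemma contractionK : cancel (@contraction R G) (@extension R G).
Proof.
move=> P.
have EP r : homogeneous G r -> extension_ideal (contraction P) r <-> (P : set R) r.
  move=> Hr; apply: iff_trans (graded_prime_sqr P Hr).
  apply: iff_trans (extension_homogeneous _ Hr) _.
  have -> : even_image (contraction P) = P `&` G 0.
    exact: val_contraction_ideal.
  split=> [[]//|Pr]; split=> //.
  by have /homogeneousE[i Gr] := Hr; exact: (graded_part_mulii Gr Gr).
have [gE _ _] := Z2spectrum_prime (extension (contraction P)).
have [gP _ _] := Z2spectrum_prime P.
have [idE _] := gE; have [idP _] := gP.
apply/Z2spectrum_inj/seteqP; split.
  by apply: graded_ideal_sub gE idP _ => r Hr /(EP r Hr).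
by apply: graded_ideal_sub gP idE _ => r Hr Pr; exact/EP.
Qed.

Lemma contraction_continuous : continuous (@contraction R G).
Proof.
apply/continuous_closedP => _ /closed_spectrumE[J _ ->].
(* The intersection of F is the graded ideal generated by J in R. *)
pose F := [set K | graded_ideal G K /\ val @` J `<=` K].
apply/closed_Z2spectrumE; exists (\bigcap_(K in F) K).
  by apply: graded_ideal_bigcap => K [].
apply/seteqP; split=> P JP.
  move=> x; apply; split; first by have [] := Z2spectrum_prime P.
  by move=> _ [y /JP ? <-].
by move=> x Jx; apply: JP => K [_]; apply; exists x.
Qed.

(** The graded ideal I lies in the extension of Q if and only if its even part
    lies in Q: a homogeneous r in I has its square in the even part of I. *)
Lemma extension_continuous : continuous (@extension R G).
Proof.
apply/continuous_closedP => _ /closed_Z2spectrumE[I gI ->].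
have [/idealP[I0 IB IM] _] := gI.
apply/closed_spectrumE; exists (val @^-1` I).
  apply/idealP; rewrite /preimage /mkset; split.
  - by rewrite raddf0.
  - by move=> x y Ix Iy; rewrite raddfB; exact: IB.
  - by move=> a x Ix; rewrite rmorphM; exact: IM.
apply/seteqP; split=> Q IQ.
  move=> x /IQ /(extension_part Q (set_mem (valP x))).
  by rewrite sqrt_part0E => /even_imageE.
apply: graded_ideal_sub gI (extension_idealP Q) _ => r Hr Ir.
apply/(extension_homogeneous Q Hr).
have /homogeneousE[i Gr] := Hr.
have [y ry] : exists y : even_subring G, r ^+ 2 = val y.
  by apply: even_lift; exact: (graded_part_mulii Gr Gr).
rewrite ry; apply/even_imageE/IQ; rewrite /preimage /mkset -ry expr2.
exact: IM.
Qed.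

End Homeomorphism.

Theorem theorem3p8 (R : comPzRingType) (G : Z2grading R) :
  homeomorphism (@contraction R G).
Proof.
exists (@extension R G); split.
- exact: contractionK.
- exact: extensionK.
- exact: contraction_continuous.
- exact: extension_continuous.
Qed.
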